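(* Let $n\ge1$ and let $\mathbf X=(X_1,\dots,X_n)^T\sim N_n(\boldsymbol\mu,\mathbf\Sigma)$ be multivariate normal with mean $\boldsymbol\mu=(\mu_1,\dots,\mu_n)^T$ and positive definite covariance matrix $\mathbf\Sigma=(\sigma_{ij})_{i,j=1}^n$. Let $p_1,\dots,p_n$ be nonnegative integers with $p_1\ge2$. Then $$\begin{aligned} E\Big[\prod_{i=1}^nX_i^{p_i}\Big]={}&\sigma_{11}E\Big[X_1^{p_1-2}\prod_{k=2}^nX_k^{p_k}\Big]+\mu_1^2E\Big[X_1^{p_1-2}\prod_{k=2}^nX_k^{p_k}\Big]\\ &+\sigma_{11}^2(p_1-2)(p_1-3)E\Big[X_1^{p_1-4}\prod_{k=2}^nX_k^{p_k}\Big]\\ &+2\sum_{j=2}^n\sigma_{11}\sigma_{j1}(p_1-2)p_jE\Big[X_1^{p_1-3}X_j^{p_j-1}\prod_{k=2,\,k\ne j}^nX_k^{p_k}\Big]\\ &+\sum_{j=2}^n\sigma_{j1}^2p_j(p_j-1)E\Big[X_1^{p_1-2}X_j^{p_j-2}\prod_{k=2,\,k\ne j}^nX_k^{p_k}\Big]\\ &+\sum_{j=2}^n\sum_{i=2,\,i\ne j}^n\sigma_{j1}\sigma_{i1}p_jp_iE\Big[X_i^{p_i-1}X_j^{p_j-1}X_1^{p_1-2}\prod_{k=2,\,k\ne i,j}^nX_k^{p_k}\Big]\\ &+2\mu_1\bigg\{\sigma_{11}(p_1-2)E\Big[X_1^{p_1-3}\prod_{k=2}^nX_k^{p_k}\Big]+\sum_{j=2}^n\sigma_{j1}p_jE\Big[X_j^{p_j-1}X_1^{p_1-2}\prod_{k=2,\,k\ne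 j}^nX_k^{p_k}\Big]\bigg\}, \end{aligned}$$ where any term whose integer coefficient vanishes is interpreted as $0$. *)

(* Defs.v *)
From HB Require Import structures.
From mathcomp Require Import all_boot all_order all_algebra.
From mathcomp Require Import all_classical all_reals all_analysis.

Set Implicit Arguments.
Unset Strict Implicit.
Unset Printing Implicit Defensive.

Import Order.TTheory GRing.Theory Num.Theory.
Import numFieldNormedType.Exports.

Local Open Scope classical_set_scope.
Local Open Scope ring_scope.

(* MathComp-Analysis equips n.-tuple R with the product of the Borel
   sigma-algebras but has no Lebesgue measure on it.  It is built here by
   recursion on n, carrying the product of the Lebesgue measures on R and R^n
   along R * R^n -> R^(n+1), (x, t) |-> x :: t.  The coordinates are taken in
   measurableTypeR R, an alias of R, because this is where lebesgue_measure
   lives. *)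

Section lebesgue_cons.
Context {R : realType} {n : nat}.
Local Notation RT := (measurableTypeR R).

Definition tuple_cons (xt : RT * n.-tuple RT) : n.+1.-tuple RT :=
  [tuple of xt.1 :: xt.2].

Lemma measurable_tuple_cons : measurable_fun setT tuple_cons.
Proof. exact: measurable_cons. Qed.

Variable m : {sigma_finite_measure set (n.-tuple RT) -> \bar R}.

Definition lebesgue_cons : set (n.+1.-tuple RT) -> \bar R :=
  pushforward (@lebesgue_measure R \x m)%E tuple_cons.

Let lebesgue_cons0 : lebesgue_cons set0 = 0%E.
Proof. by rewrite /lebesgue_cons /pushforward preimage_set0 measure0. Qed.

Let lebesgue_cons_ge0 A : (0 <= lebesgue_cons A)%E.
Proof. by rewrite /lebesgue_cons /pushforward measure_ge0. Qed.

Let lebesgue_cons_sigma_additive : semi_sigma_additive lebesgue_cons.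
Proof.
move=> F mF tF mUF; rewrite /lebesgue_cons /pushforward preimage_bigcup.
have mpre A : measurable A -> measurable (tuple_cons @^-1` A).
  by move=> mA; rewrite -[X in measurable X]setTI; exact: measurable_tuple_cons.
apply: measure_semi_sigma_additive.
- by move=> k; exact: mpre.
- apply/trivIsetP => /= i j _ _ ij; rewrite -preimage_setI.
  by move/trivIsetP : tF => /(_ _ _ _ _ ij) ->//; rewrite preimage_set0.
- by rewrite -preimage_bigcup; exact: mpre.
Qed.

HB.instance Definition _ := isMeasure.Build _ _ _ lebesgue_cons
  lebesgue_cons0 lebesgue_cons_ge0 lebesgue_cons_sigma_additive.

Lemma sigma_finite_lebesgue_cons : sigma_finite setT lebesgue_cons.
Proof.
have /sigma_finiteP[F [UF ndF mF]] := sigma_finiteT (@lebesgue_measure R).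
have /sigma_finiteP[G [UG ndG mG]] := sigma_finiteT m.
pose u (t : n.+1.-tuple RT) : RT * n.-tuple RT := (thead t, [tuple of behead t]).
have Ku A : tuple_cons @^-1` (u @^-1` A) = A.
  rewrite -comp_preimage (_ : u \o _ = id) ?preimage_id//.
  by apply/funext => -[x t]; congr pair; apply: val_inj.
have mu : measurable_fun setT u.
  apply: measurable_fun_pair; first exact: measurable_tnth.
  exact: measurable_behead.
exists (fun k => u @^-1` (F k `*` G k)).
  rewrite -preimage_bigcup (_ : \bigcup_k _ = setT) ?preimage_setT//.
  rewrite -setXTT UF UG predeqE => -[x t]; split => [[k _ [Fx Gt]]|[[i _ Fx] [j _ Gt]]].
    by split; exists k.
  exists (maxn i j) => //; split.
  - exact: (subsetPset _ _ (ndF _ _ (leq_maxl i j))).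
  - exact: (subsetPset _ _ (ndG _ _ (leq_maxr i j))).
move=> k; have [mFk Fk] := mF k; have [mGk Gk] := mG k.
have mFG : measurable (F k `*` G k) by exact: measurableX.
split; first by rewrite -[X in measurable X]setTI; exact: mu.
rewrite /lebesgue_cons /pushforward Ku.
by rewrite product_measure1E// lte_mul_pinfty// ge0_fin_numE.
Qed.

HB.instance Definition _ :=
  Measure_isSigmaFinite.Build _ _ _ lebesgue_cons sigma_finite_lebesgue_cons.

End lebesgue_cons.

Fixpoint lebesgue_tuple {R : realType} (n : nat) :
    {sigma_finite_measure set (n.-tuple (measurableTypeR R)) -> \bar R} :=
  match n with
  | 0 => \d_([tuple] : 0.-tuple (measurableTypeR R))
  | n'.+1 => lebesgue_cons (lebesgue_tuple n')
  end.

Section multivariate_normal.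
Context {R : realType} {n : nat}.
Implicit Types (mu : 'cV[R]_n) (Sigma : 'M[R]_n).

Definition posdefmx Sigma : Prop :=
  Sigma^T = Sigma /\
  forall v : 'cV[R]_n, v != 0 -> 0 < (v^T *m Sigma *m v) 0 0.

Definition mvnormal_pdf mu Sigma (x : n.-tuple R) : R :=
  let v := (\col_i tnth x i) - mu in
  (Num.sqrt ((2 * pi) ^+ n * \det Sigma))^-1 *
  expR (- (v^T *m invmx Sigma *m v) 0 0 / 2).

(* Meaningful for positive definite Sigma only. *)
Definition mvnormal d (T : measurableType d) (P : probability T R)
    (X : 'I_n -> {RV P >-> R}) mu Sigma : Prop :=
  forall B : set (n.-tuple (measurableTypeR R)), measurable B ->
    P [set w | B [tuple X i w | i < n]] =
    (\int[lebesgue_tuple n]_(x in B) (mvnormal_pdf mu Sigma x)%:E)%E.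

End multivariate_normal.

(* Main.v *)
Require Import Defs.
From HB Require Import structures.
From mathcomp Require Import all_boot all_order all_algebra.
From mathcomp Require Import all_classical all_reals all_analysis.
From mathcomp Require Import measurable_realfun ring lra.

Set Implicit Arguments.
Unset Strict Implicit.
Unset Printing Implicit Defensive.

Import Order.TTheory GRing.Theory Num.Theory.
Import numFieldNormedType.Exports.

Local Open Scope classical_set_scope.
Local Open Scope ring_scope.

(** Write A for the inverse of Sigma and phi for the density.  The gradient of
    phi at x is - phi(x) A (x - mu), so integrating the derivative of
    x^k phi(x) in the direction j, where x^k is the monomial of exponents k,
    over the whole space gives

      k_j M(k - e_j) = sum_i A_ji (M(k + e_i) - mu_i M(k)),

    where M(k) is the integral of x^k phi(x) and e_j is the j-th unit exponent
    ([moment_precision]).  Multiplying by Sigma and summing over j inverts A and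
    leaves Stein's identity ([moment_incr])

      M(k + e_j) = mu_j M(k) + sum_i Sigma_ji k_i M(k - e_i).

    Using it twice expresses M(k + 2 e_j) by M(k) and the moments with one or
    two factors removed ([moment_incr2]); the theorem is the case j = ord0, with
    the double sum split according to which of its indices are ord0 and which
    coincide ([sum2D1]).

    The integration by parts is done one line at a time, by Fubini's theorem in
    one coordinate ([integral_tuple_line0]): along a line in a coordinate
    direction, phi is a constant times a Gaussian in one variable, and the
    fundamental theorem of calculus applies
    ([integral_derive_gauss_moment]).  Integrability of x^k phi(x) comes from
    the bound A >= (1/n) diag(1/Sigma_ii) between quadratic forms
    ([precision_ge_sum]), a consequence of Cauchy-Schwarz, which dominates phi by
    a product of Gaussians in one variable each. *)

(** * The quadratic form of the precision matrix *)

Section precision_matrix.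
Context {R : realType} {n : nat}.
Implicit Types (S : 'M[R]_n) (v : 'cV[R]_n).

Lemma posdefmx_unit S : posdefmx S -> S \in unitmx.
Proof.
move=> [_ pS]; rewrite -row_free_unit -kermx_eq0; apply/eqP/row_matrixP => i.
rewrite row0; apply/eqP/negPn/negP => vN0.
have := pS (row i (kermx S))^T; rewrite -(inj_eq trmx_inj) trmxK trmx0 => /(_ vN0).
by rewrite -row_mul mulmx_ker row0 mul0mx mxE ltxx.
Qed.

Lemma posdefmx_inv S : posdefmx S -> posdefmx (invmx S).
Proof.
move=> pS; have uS := posdefmx_unit pS; have [sS qS] := pS.
have sA : (invmx S)^T = invmx S by rewrite trmx_inv sS.
split=> // v v0; have /qS : invmx S *m v != 0.
  by apply: contra_neq v0 => /(congr1 (mulmx S)); rewrite mulKVmx// mulmx0.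
by rewrite trmx_mul sA -!mulmxA mulKVmx.
Qed.

Lemma posdefmx_diag_gt0 S i : posdefmx S -> 0 < S i i.
Proof.
move=> [_ /(_ (delta_mx i 0))]; rewrite trmx_delta -rowE -colE !mxE; apply.
by apply/eqP => /matrixP/(_ i 0)/eqP; rewrite !mxE !eqxx oner_eq0.
Qed.

Lemma quad_line (A : 'M[R]_n) v w t : A^T = A ->
  ((v + t *: w)^T *m A *m (v + t *: w)) 0 0 =
  (v^T *m A *m v) 0 0 + t * (w^T *m A *m v) 0 0 *+ 2 +
  t ^+ 2 * (w^T *m A *m w) 0 0.
Proof.
move=> sA.
have addE (M N : 'M[R]_1) : (M + N) 0 0 = M 0 0 + N 0 0 by rewrite mxE.
have scaleE a (M : 'M[R]_1) : (a *: M) 0 0 = a * M 0 0 by rewrite mxE.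
have vw : (v^T *m A *m w) 0 0 = (w^T *m A *m v) 0 0.
  by rewrite -[in LHS](trmxK (v^T *m A *m w)) mxE !trmx_mul trmxK sA mulmxA.
rewrite [(_ + _)^T]linearD/= [(_ *: _)^T]linearZ/=.
rewrite !mulmxDl !mulmxDr -!scalemxAl -!scalemxAr.
by rewrite !addE !scaleE vw; ring.
Qed.

(** Cauchy-Schwarz for the inner product defined by the inverse of S, applied to
    v and the i-th column of S: their inner product is v i, and the square norm
    of the column is S i i. *)
Lemma precision_coord_le S v i : posdefmx S ->
  v i 0 ^+ 2 / S i i <= (v^T *m invmx S *m v) 0 0.
Proof.
move=> pS; have uS := posdefmx_unit pS; have Sii := posdefmx_diag_gt0 i pS.
have [sA qA] := posdefmx_inv pS.
(* The component of v orthogonal to the column is v + w. *)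
pose w := - (v i 0 / S i i) *: col i S.
have : 0 <= ((v + w)^T *m invmx S *m (v + w)) 0 0.
  by have [->|/qA/ltW//] := eqVneq (v + w) 0; rewrite mulmx0 mxE.
rewrite quad_line//.
have -> : (col i S)^T *m invmx S = delta_mx 0 i.
  by rewrite colE trmx_mul trmx_delta (proj1 pS) mulmxK.
rewrite -rowE -[delta_mx 0 i *m col i S]rowE !mxE => h.
rewrite -subr_ge0; apply: le_trans h _; rewrite le_eqVlt; apply/orP; left.
apply/eqP; field; exact: lt0r_neq0.
Qed.

Lemma precision_ge_sum S v : posdefmx S ->
  n%:R^-1 * \sum_i v i 0 ^+ 2 / S i i <= (v^T *m invmx S *m v) 0 0.
Proof.
move=> pS; have [n0|n0] := posnP n.
  rewrite big1 ?mulr0; last by move=> i _; exfalso; case: i; rewrite n0.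
  have [->|/((posdefmx_inv pS).2)/ltW//] := eqVneq v 0.
  by rewrite mulmx0 mxE.
rewrite ler_pdivrMl ?ltr0n//.
rewrite (le_trans (ler_sum _ (fun i _ => precision_coord_le v i pS)))//.
by rewrite sumr_const card_ord mulr_natl.
Qed.

End precision_matrix.

(** * Gaussian moments on the line *)

Section gaussian_line.
Context {R : realType}.
Local Notation leb := (@lebesgue_measure R).
Implicit Types a b m t : R.

Lemma exprn_le_expR t k : `|t| ^+ k <= k`!%:R * expR `|t|.
Proof.
case: k => [|k]; first by rewrite expr0 fact0 mul1r -expR0 ler_expR.
rewrite mulrC -ler_pdivrMr ?ltr0n ?fact_gt0//.
by rewrite (le_trans _ (expR_ge1Dxn k (normr_ge0 t)))// lerDr.
Qed.

(** Half of the exponent absorbs the centre m, and half of the rest absorbs the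
    power, because |t|^k <= k! exp |t| and |t| <= a t^2 / 4 + 1 / a. *)
Lemma gauss_moment_bound a m k : 0 < a -> exists C b,
  [/\ 0 <= C, 0 < b &
   forall t, `|t| ^+ k * expR (- (a * (t - m) ^+ 2)) <= C * expR (- (b * t ^+ 2))].
Proof.
move=> a0; exists (k`!%:R * expR (a^-1 + a * m ^+ 2)), (a / 4); split.
- by rewrite mulr_ge0 ?expR_ge0.
- by rewrite divr_gt0.
move=> t; rewrite (le_trans (ler_wpM2r (expR_ge0 _) (exprn_le_expR _ _)))//.
rewrite -!mulrA ler_wpM2l// -!expRD ler_expR.
have tE : t ^+ 2 = `|t| ^+ 2 by rewrite real_normK ?num_real.
have h1 : `|t| <= a * t ^+ 2 / 4 + a^-1.
  rewrite -subr_ge0 tE.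
  have -> : a * `|t| ^+ 2 / 4 + a^-1 - `|t| = a^-1 * (a * `|t| / 2 - 1) ^+ 2.
    by field; exact: lt0r_neq0.
  by rewrite mulr_ge0 ?sqr_ge0// invr_ge0 ltW.
have h2 : 0 <= a * (t / 2 - m) ^+ 2 by rewrite mulr_ge0 ?sqr_ge0// ltW.
rewrite -subr_ge0 in h1; rewrite -subr_ge0.
lra.
Qed.

Lemma measurable_gauss_moment a m k :
  measurable_fun setT (fun t => t ^+ k * expR (- (a * (t - m) ^+ 2))).
Proof.
apply: measurable_funM; first exact: measurable_funX.
apply: measurableT_comp => //; apply: measurableT_comp => //.
apply: measurable_funM => //; apply: measurable_funX.
exact: measurable_funB.
Qed.

(** Up to a constant, the integrand is a normal density of variance 1 / (2 b). *)
Lemma integrable_gauss b : 0 < b ->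
  leb.-integrable setT (fun t => (expR (- (b * t ^+ 2)))%:E).
Proof.
move=> b0; pose s := Num.sqrt (2 * b)^-1.
have s0 : s != 0 by rewrite gt_eqF// sqrtr_gt0 invr_gt0 mulr_gt0.
have := integrableZl measurableT (normal_peak s)^-1 (integrable_normal_pdf 0 s).
apply: eq_integrable => // t _; rewrite normal_pdfE//= -EFinM; congr EFin.
rewrite mulKf ?gt_eqF ?normal_peak_gt0// /normal_fun subr0.
rewrite sqr_sqrtr ?invr_ge0 ?mulr_ge0 ?(ltW b0)//; congr expR.
by field; rewrite gt_eqF.
Qed.

Lemma integrable_gauss_moment a m k : 0 < a ->
  leb.-integrable setT (fun t => (t ^+ k * expR (- (a * (t - m) ^+ 2)))%:E).
Proof.
move=> a0; have [C [b [C0 b0 Cb]]] := gauss_moment_bound m k a0.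
apply: (le_integrable measurableT) (integrableZl measurableT C (integrable_gauss b0)).
  by apply/measurable_EFinP; exact: measurable_gauss_moment.
move=> t _; rewrite /= lee_fin normrM normrX (ger0_norm (expR_ge0 _)).
by rewrite [leRHS]ger0_norm ?mulr_ge0 ?expR_ge0.
Qed.

Lemma is_derive_gauss_moment a m k t :
  is_derive t 1 (fun t => t ^+ k * expR (- (a * (t - m) ^+ 2)) : R)
    ((k%:R * t ^+ k.-1 - t ^+ k * (2 * a * (t - m))) *
      expR (- (a * (t - m) ^+ 2))).
Proof.
have -> : (fun t => t ^+ k * expR (- (a * (t - m) ^+ 2)) : R) =
    id ^+ k * (expR \o (cst (- a) * (id - cst m) ^+ 2)).
  by apply/funext => x; rewrite !fctE/= mulNr.
apply: is_derive_eq.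
rewrite !fctE/= /GRing.scale/= mulNr; ring.
Qed.

Lemma continuous_gauss_moment a m k :
  continuous (fun t => t ^+ k * expR (- (a * (t - m) ^+ 2)) : R).
Proof.
move=> t; apply: differentiable_continuous; apply/derivable1_diffP.
exact: (@ex_derive _ _ _ _ _ _ _ (is_derive_gauss_moment a m k t)).
Qed.

(** Stated along a sequence of points of absolute value i.+1, to cover both ends
    of the interval [-i.+1, i.+1]. *)
Lemma cvg_gauss_moment0 a m k (u : nat -> R) : 0 < a ->
  (forall i, `|u i| = i.+1%:R) ->
  u i ^+ k * expR (- (a * (u i - m) ^+ 2)) @[i --> \oo] --> (0 : R).
Proof.
move=> a0 ui; have [C [b [C0 b0 Cb]]] := gauss_moment_bound m k a0.
apply/norm_cvg0P.
have h : (C / b) * i.+1%:R^-1 @[i --> \oo] --> (0:R).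
  rewrite -[X in _ --> X](mulr0 (C / b)).
  by apply: cvgM; [exact: cvg_cst|exact: cvg_harmonic].
apply: squeeze_cvgr h; last exact: cvg_cst.
apply: nearW => i /=; rewrite normr_ge0 normrM normrX (ger0_norm (expR_ge0 _)).
rewrite (le_trans (Cb _))// -mulrA ler_wpM2l// -real_normK ?num_real// ui.
rewrite expRN -invfM lef_pV2 ?posrE ?expR_gt0 ?mulr_gt0//.
rewrite (le_trans _ (expR_ge1Dx _))//.
rewrite (@le_trans _ _ (b * i.+1%:R ^+ 2)) ?lerDr// ler_wpM2l ?(ltW b0)//.
by rewrite expr2 ler_peMr// ler1n.
Qed.

Lemma integrable_derive_gauss_moment a m k : 0 < a ->
  leb.-integrable setT (fun t =>
    ((k%:R * t ^+ k.-1 - t ^+ k * (2 * a * (t - m))) *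
      expR (- (a * (t - m) ^+ 2)))%:E).
Proof.
move=> a0.
have iG c l := integrableZl measurableT c (integrable_gauss_moment m l a0).
apply: eq_integrable (integrableD measurableT (iG k%:R k.-1)
  (integrableD measurableT (iG (- (2 * a)) k.+1) (iG (2 * a * m) k))) => //.
move=> t _ /=; rewrite -!EFinM -!EFinD (exprS t k); congr EFin; ring.
Qed.

(** The integral over [-N, N] is the difference of the values of the primitive at
    both ends, which tends to 0, and it tends to the full integral by dominated
    convergence. *)
Lemma integral_derive_gauss_moment a m k : 0 < a ->
  (\int[leb]_t ((k%:R * t ^+ k.-1 - t ^+ k * (2 * a * (t - m))) *
      expR (- (a * (t - m) ^+ 2)))%:E = 0)%E.
Proof.
move=> a0; (* The radius i.+1 keeps every interval nondegenerate. *)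
pose D (i : nat) : set R := `[- i.+1%:R, i.+1%:R]%classic.
set f := (X in (\int[leb]_t (X t))%E = _).
pose G l t := t ^+ l * expR (- (a * (t - m) ^+ 2)).
pose g t := k%:R * G k.-1 t + (- (2 * a) * G k.+1 t + 2 * a * m * G k t).
have fE : f = EFin \o g.
  by apply/funext => t; rewrite /f/= /g /G (exprS t k); congr EFin; ring.
have cg : continuous g.
  move=> t; have cG l : {for t, continuous (G l)} := @continuous_gauss_moment a m l t.
  by apply: cvgD; [|apply: cvgD]; apply: cvgM; (try exact: cvg_cst); exact: cG.
have ig : leb.-integrable setT f by exact: integrable_derive_gauss_moment.
have mf : measurable_fun setT f by exact: measurable_int ig.
have intD i : (\int[leb]_t (f \_ (D i)) t = (G k i.+1%:R - G k (- i.+1%:R))%:E)%E.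
  rewrite -integral_mkcond fE EFinB.
  apply: (@continuous_FTC2 _ g (G k)).
  - by rewrite gtrN.
  - exact: continuous_subspaceT.
  - split => [t _||].
    + exact: (@ex_derive _ _ _ _ _ _ _ (is_derive_gauss_moment a m k t)).
    + exact/cvg_at_right_filter/continuous_gauss_moment.
    + exact/cvg_at_left_filter/continuous_gauss_moment.
  - move=> t _; rewrite derive1E.
    rewrite (@derive_val _ _ _ _ _ _ _ (is_derive_gauss_moment a m k t)).
    by rewrite /g /G (exprS t k); ring.
have [] := @dominated_convergence _ _ _ leb setT measurableT
    (fun i => f \_ (D i)) f (abse \o f).
- move=> i; apply/(measurable_restrictT _ _).1; first exact: measurable_itv.
  exact: measurable_funTS.
- exact: mf.
- apply: aeW => t _; apply: cvg_near_cst; near=> i.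
  rewrite patchE mem_set// /D/= in_itv/= -ler_norml.
  have : `|t| <= i%:R by near: i; exact: nbhs_infty_ger.
  by move=> /le_trans; apply; rewrite ler_nat.
- exact: integrable_abse.
- apply: aeW => t i _; rewrite patchE; case: ifP => // _.
  by rewrite [X in abse X](_ : _ = 0%E) // abse0 abse_ge0.
move=> _ _ h.
have h0 : (\int[leb]_t (f \_ (D i)) t)%E @[i --> \oo] --> 0%E.
  under eq_fun do rewrite intD.
  apply: cvg_EFin; first exact: nearW.
  rewrite -[X in _ --> X](subr0 0); apply: cvgB.
  - by apply: cvg_gauss_moment0 => // i; rewrite normr_nat.
  - by apply: (@cvg_gauss_moment0 _ _ _ (fun i => - i.+1%:R)) => // i; rewrite normrN normr_nat.
exact: cvg_unique h h0.
Unshelve. all: by end_near. Qed.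

End gaussian_line.

(** * Integration over tuples *)

Section lebesgue_tuple.
Context {R : realType}.
Local Notation RT := (measurableTypeR R).
Local Notation leb := (@lebesgue_measure R).

Lemma integrable_tuple_cons n (F : n.+1.-tuple RT -> \bar R) :
  (lebesgue_tuple n.+1).-integrable setT F <->
  measurable_fun setT F /\
  (leb \x lebesgue_tuple n)%E.-integrable setT (F \o tuple_cons).
Proof.
split=> [iF|[mF iF]].
  have mF : measurable_fun setT F by exact: measurable_int iF.
  split=> //; apply/integrableP; split.
    by apply: measurableT_comp => //; exact: measurable_tuple_cons.
  move/integrableP : iF => [_]; apply: le_lt_trans.
  rewrite (@ge0_integral_pushforward _ _ _ _ R _ (@measurable_tuple_cons R n)
    (leb \x lebesgue_tuple n)%E setT (abse \o F))//.
    exact: measurableT_comp.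
  by move=> y _; exact: abse_ge0.
have := @integrable_pushforward _ _ _ _ R _ (@measurable_tuple_cons R n)
    (leb \x lebesgue_tuple n)%E setT F mF iF measurableT.
exact.
Qed.

Lemma integral_tuple_cons n (F : n.+1.-tuple RT -> \bar R) :
  (lebesgue_tuple n.+1).-integrable setT F ->
  (\int[lebesgue_tuple n.+1]_x F x =
   \int[leb \x lebesgue_tuple n]_xt F (tuple_cons xt))%E.
Proof.
move=> /integrable_tuple_cons[mF iF].
have := @integral_pushforward _ _ _ _ R _ (@measurable_tuple_cons R n)
    (leb \x lebesgue_tuple n)%E setT F mF iF measurableT.
exact.
Qed.

Lemma integrable_tuple_prod n (g : 'I_n -> RT -> R) :
  (forall i, leb.-integrable setT (EFin \o g i)) ->
  (lebesgue_tuple n).-integrable setT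
    (fun x => (\prod_(i < n) g i (tnth x i))%:E).
Proof.
elim: n g => [|n IH] g ig.
  apply/integrableP; split.
    by apply/measurable_EFinP; apply: measurable_prod => -[].
  rewrite integral_dirac//=; first by rewrite diracT mul1e ltry.
  by apply/measurable_EFinP/measurableT_comp => //; apply: measurable_prod => -[].
have mg i : measurable_fun setT (g i).
  by apply/measurable_EFinP; exact: measurable_int (ig i).
have mF : measurable_fun setT (fun x : n.+1.-tuple RT =>
    (\prod_(i < n.+1) g i (tnth x i))%:E).
  apply/measurable_EFinP; apply: measurable_prod => i _.
  apply: measurableT_comp => //; exact: measurable_tnth.
apply/integrable_tuple_cons; split=> //.
have iH := IH _ (fun i => ig (lift ord0 i)).
set h := (X in integrable _ _ X) in iH.
apply/integrable12ltyP.
  by apply: measurableT_comp => //; exact: measurable_tuple_cons.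
have fE x y : (\prod_(i < n.+1) g i (tnth (tuple_cons (x, y)) i))%:E =
    ((g ord0 x)%:E * h y)%E.
  rewrite big_ord_recl tnth0 EFinM; congr (_ * _%:E)%E.
  by apply: eq_bigr => i _; rewrite tnthS.
have mh : measurable_fun setT (abse \o h).
  by apply: measurableT_comp => //; exact: measurable_int iH.
under eq_integral => x _.
  under eq_integral do rewrite [X in abse X]fE abseM.
  rewrite ge0_integralZl//.
  over.
have h0 : (0 <= \int[lebesgue_tuple n]_y `|h y|)%E.
  by apply: integral_ge0 => y _; exact: abse_ge0.
rewrite ge0_integralZr//; last first.
  by apply: measurableT_comp => //; exact/measurable_EFinP.
move/integrableP: iH => [_ iH]; move/integrableP: (ig ord0) => [_ i0].
apply: lte_mul_pinfty => //; first by apply: integral_ge0 => y _; exact: abse_ge0.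
by rewrite ge0_fin_numE//; apply: integral_ge0 => y _; exact: abse_ge0.
Qed.

Definition tuple_upd n (x : n.-tuple R) (j : 'I_n) (t : R) : n.-tuple R :=
  [tuple if i == j then t else tnth x i | i < n].

(** Fubini in one coordinate.  The recursion defining the measure on tuples peels
    off the first coordinate, so the induction integrates over the line first
    when j is ord0, and last otherwise. *)
Lemma integral_tuple_line0 n (j : 'I_n) (F : n.-tuple RT -> \bar R) :
  (lebesgue_tuple n).-integrable setT F ->
  (forall x, \int[leb]_t F (tuple_upd x j t) = 0)%E ->
  (\int[lebesgue_tuple n]_x F x = 0)%E.
Proof.
elim: n j F => [[]//|n IH] j F iF F0.
rewrite integral_tuple_cons//; have [mF iFc] := (integrable_tuple_cons F).1 iF.
case: (unliftP ord0 j) F0 => [j' ->|->] F0.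
- rewrite -[LHS](integral12_prod_meas1 iFc) (ae_eq_integral (cst 0%E))//.
  + exact: integral0.
  + exact: (measurable_fubini_F iFc).
  apply: filterS (ae_integrable1 iFc) => x ix _.
  apply: (IH j' (fun y => F (tuple_cons (x, y)))) => // y.
  rewrite -[RHS](F0 (tuple_cons (x, y))); apply: eq_integral => t _; congr F.
  apply: eq_from_tnth => i; rewrite [RHS]tnth_mktuple.
  have [i' ->|->] := unliftP ord0 i; last by rewrite !tnth0.
  by rewrite !tnthS (inj_eq lift_inj) tnth_mktuple.
- rewrite -[LHS](integral21_prod_meas1 iFc) /fubini_G integral0_eq// => y _.
  rewrite -[RHS](F0 (tuple_cons (0, y))); apply: eq_integral => t _; congr F.
  apply: eq_from_tnth => i; rewrite [RHS]tnth_mktuple.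
  have [i' ->|->] := unliftP ord0 i; last by rewrite tnth0 eqxx.
  by rewrite !tnthS.
Qed.

End lebesgue_tuple.

(** * Stein's identity for the moments of the density *)

Section gaussian_density.
Context {R : realType} {n : nat} (mu : 'cV[R]_n) (Sigma : 'M[R]_n).
Hypothesis pS : posdefmx Sigma.
Local Notation RT := (measurableTypeR R).
Local Notation leb := (@lebesgue_measure R).
Local Notation L := (lebesgue_tuple n).
Local Notation A := (invmx Sigma).
Local Notation pdf := (mvnormal_pdf mu Sigma).
Implicit Types (k : 'I_n -> nat) (x : n.-tuple R) (i j : 'I_n).

Definition mono k x : R := \prod_(i < n) tnth x i ^+ k i.

Definition incr k j i := (k i + (i == j))%N.

Definition decr k j i := (k i - (i == j))%N.

Lemma measurable_mono k : measurable_fun setT (mono k : n.-tuple RT -> R).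
Proof.
apply: measurable_prod => i _; apply: measurable_funX.
exact: (@measurable_tnth _ RT).
Qed.

Lemma measurable_mvnormal_pdf : measurable_fun setT (pdf : n.-tuple RT -> R).
Proof.
apply: measurable_funM => //; apply: measurableT_comp => //.
apply: measurable_funM => //; apply: measurableT_comp => //.
have mv i : measurable_fun setT (fun x : n.-tuple RT => tnth x i - mu i 0).
  by apply: measurable_funB => //; exact: (@measurable_tnth _ RT).
under eq_fun do rewrite mxE.
apply: measurable_sum => j; apply: measurable_funM; last first.
  by under eq_fun do rewrite !mxE; exact: mv.
under eq_fun do rewrite mxE.
apply: measurable_sum => i; apply: measurable_funM => //.
by under eq_fun do rewrite !mxE; exact: mv.
Qed.

Lemma mvnormal_pdf_ge0 x : 0 <= pdf x.
Proof. by rewrite mulr_ge0 ?expR_ge0// invr_ge0. Qed.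

Lemma mvnormal_pdf_le_prod x :
  pdf x <= (Num.sqrt ((2 * pi) ^+ n * \det Sigma))^-1 *
    \prod_(i < n) expR (- ((2 * n%:R * Sigma i i)^-1 * (tnth x i - mu i 0) ^+ 2)).
Proof.
rewrite ler_wpM2l ?invr_ge0// -expR_sum ler_expR sumrN mulNr lerN2.
rewrite ler_pdivlMr//; apply: le_trans (precision_ge_sum _ pS).
rewrite le_eqVlt; apply/orP; left; apply/eqP.
rewrite big_distrl big_distrr/=; apply: eq_bigr => i _.
rewrite !mxE !invfM.
transitivity (n%:R^-1 * ((tnth x i - mu i 0) ^+ 2 / Sigma i i) * (2^-1 * 2)); first by ring.
by rewrite mulVf ?mulr1 ?pnatr_eq0.
Qed.

Lemma integrable_mono_pdf k :
  L.-integrable setT (fun x => (mono k x * pdf x)%:E).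
Proof.
pose c := (Num.sqrt ((2 * pi) ^+ n * \det Sigma))^-1.
have c0 : 0 <= c by rewrite invr_ge0.
pose g i (t : RT) : R :=
  t ^+ k i * expR (- ((2 * n%:R * Sigma i i)^-1 * (t - mu i 0) ^+ 2)).
have ig : L.-integrable setT (fun x => (\prod_(i < n) g i (tnth x i))%:E).
  apply: integrable_tuple_prod => i; apply: integrable_gauss_moment.
  rewrite invr_gt0 !mulr_gt0 ?posdefmx_diag_gt0// ltr0n.
  by case: (n) i => [[]|].
apply: (le_integrable measurableT) (integrableZl measurableT c ig).
  apply/measurable_EFinP; apply: measurable_funM.
    exact: measurable_mono.
  exact: measurable_mvnormal_pdf.
move=> x _; rewrite /= lee_fin normrM [`|pdf x|]ger0_norm ?mvnormal_pdf_ge0//.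
rewrite [leRHS]normrM big_split/= normrM [leRHS]mulrCA ler_wpM2l//.
rewrite (le_trans (mvnormal_pdf_le_prod x))// -/c (ger0_norm c0).
by rewrite ler_wpM2l// ler_norm.
Qed.

Lemma centered_tuple_upd x j t (v0 := (\col_i tnth (tuple_upd x j 0) i) - mu) :
  (\col_i tnth (tuple_upd x j t) i) - mu = v0 + t *: delta_mx j 0.
Proof.
apply/matrixP => i l; rewrite !mxE !tnth_mktuple (ord1 l) eqxx andbT.
by case: (i == j) => /=; ring.
Qed.

Lemma mono_tuple_upd k x j t :
  mono k (tuple_upd x j t) = t ^+ k j * \prod_(i < n | i != j) tnth x i ^+ k i.
Proof.
rewrite /mono (bigD1 j)//= tnth_mktuple eqxx; congr (_ * _).
by apply: eq_bigr => i /negPf ij; rewrite tnth_mktuple ij.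
Qed.

(** This is the derivative of mono k * pdf in the direction j, because the
    gradient of the density at x is - pdf x *: A *m (x - mu). *)
Definition dmono_pdf k j x : R :=
  (k j)%:R * (mono (decr k j) x * pdf x) -
  mono k x * pdf x * (A *m ((\col_i tnth x i) - mu)) j 0.

(** Along the line through x in the direction j, the exponent of the density is a
    quadratic polynomial in t with leading coefficient - A j j / 2; completing the
    square turns the integrand into a constant times the derivative of a Gaussian
    moment on the line. *)
Lemma integral_line_dmono_pdf k j x :
  (\int[leb]_t (dmono_pdf k j (tuple_upd x j t))%:E = 0)%E.
Proof.
pose v0 := (\col_i tnth (tuple_upd x j 0) i) - mu.
pose al := A j j; pose be := (A *m v0) j 0; pose q := (v0^T *m A *m v0) 0 0.
have al0 : 0 < al by apply/posdefmx_diag_gt0/posdefmx_inv.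
pose K := \prod_(i < n | i != j) tnth x i ^+ k i *
  ((Num.sqrt ((2 * pi) ^+ n * \det Sigma))^-1 * expR ((be ^+ 2 / al - q) / 2)).
have pdfE t : pdf (tuple_upd x j t) =
    (Num.sqrt ((2 * pi) ^+ n * \det Sigma))^-1 * expR ((be ^+ 2 / al - q) / 2) *
    expR (- (al / 2 * (t - - (be / al)) ^+ 2)).
  rewrite /mvnormal_pdf centered_tuple_upd quad_line; last exact: (posdefmx_inv pS).1.
  rewrite -mulrA -expRD -/v0 trmx_delta -!mulmxA -!rowE -colE.
  have -> : row j (A *m v0) 0 0 = be by rewrite mxE.
  have -> : row j (col j A) 0 0 = al by rewrite !mxE.
  rewrite mulmxA -/q; congr (_ * expR _); field; exact: lt0r_neq0.
have linE t : (A *m ((\col_i tnth (tuple_upd x j t) i) - mu)) j 0 =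
    2 * (al / 2) * (t - - (be / al)).
  rewrite centered_tuple_upd -/v0 mulmxDr -scalemxAr -colE.
  rewrite mxE [X in _ + X]mxE [X in _ + _ * X]mxE -/al -/be.
  field; exact: lt0r_neq0.
under eq_integral => t _.
  rewrite /dmono_pdf pdfE linE !mono_tuple_upd.
  rewrite {1}/decr eqxx subn1.
  have -> : \prod_(i < n | i != j) tnth x i ^+ decr k j i =
      \prod_(i < n | i != j) tnth x i ^+ k i.
    by apply: eq_bigr => i /negPf ij; rewrite /decr ij subn0.
  rewrite [X in X%:E](_ : _ = K * (((k j)%:R * t ^+ (k j).-1 -
    t ^+ k j * (2 * (al / 2) * (t - - (be / al)))) *
    expR (- (al / 2 * (t - - (be / al)) ^+ 2)))); last by rewrite /K; ring.
  rewrite EFinM.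
  over.
rewrite integralZl//; last first.
  by apply: integrable_derive_gauss_moment; rewrite divr_gt0.
by rewrite integral_derive_gauss_moment ?mule0// divr_gt0.
Qed.

Lemma mono_incr k j x : mono (incr k j) x = tnth x j * mono k x.
Proof.
rewrite /mono (bigD1 j)//= [in RHS](bigD1 j)//= mulrA -exprS /incr eqxx addn1.
congr (_ * _); by apply: eq_bigr => i /negPf ij; rewrite ij addn0.
Qed.

Lemma dmono_pdfE k j x : dmono_pdf k j x =
  (k j)%:R * (mono (decr k j) x * pdf x) -
  \sum_i (A j i * (mono (incr k i) x * pdf x) -
           A j i * mu i 0 * (mono k x * pdf x)).
Proof.
rewrite /dmono_pdf mxE big_distrr/=; congr (_ - _).
by apply: eq_bigr => i _; rewrite !mxE mono_incr; ring.
Qed.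

(** These integrals converge by [integrable_mono_pdf]. *)
Definition moment k : R := \int[L]_x (mono k x * pdf x).

(** Integration by parts in the coordinate j. *)
Lemma moment_precision k j :
  (k j)%:R * moment (decr k j) =
  \sum_i A j i * (moment (incr k i) - mu i 0 * moment k).
Proof.
have iZ c l : L.-integrable setT (EFin \o (fun x => c * (mono l x * pdf x))).
  exact: (integrableZl measurableT c (integrable_mono_pdf l)).
have iB i : L.-integrable setT (EFin \o (fun x =>
    A j i * (mono (incr k i) x * pdf x) -
    A j i * mu i 0 * (mono k x * pdf x))).
  exact: (integrableB measurableT (iZ _ _) (iZ _ _)).
have iS : L.-integrable setT (EFin \o (fun x =>
    \sum_i (A j i * (mono (incr k i) x * pdf x) -
           A j i * mu i 0 * (mono k x * pdf x)))).
  rewrite [X in integrable _ _ X](_ : _ = fun x =>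
    (\sum_i (A j i * (mono (incr k i) x * pdf x) -
             A j i * mu i 0 * (mono k x * pdf x))%:E)%E); last first.
    by apply/funext => x /=; rewrite sumEFin.
  by apply: integrable_sum => // i _; exact: iB.
have : \int[L]_x dmono_pdf k j x = 0.
  rewrite /Rintegral (integral_tuple_line0 (j := j))//.
    under [X in integrable _ _ X]eq_fun do rewrite dmono_pdfE.
    exact: (integrableB measurableT (iZ _ _) iS).
  exact: integral_line_dmono_pdf.
under eq_Rintegral do rewrite dmono_pdfE.
rewrite RintegralB// RintegralZl//; last exact: integrable_mono_pdf.
move/eqP; rewrite subr_eq0 => /eqP ->.
rewrite /Rintegral; under eq_integral do rewrite -sumEFin.
rewrite integral_sum// -sum_fine; last first.
  by move=> i _; exact: (integrable_fin_num measurableT (iB i)).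
apply: eq_bigr => i _; rewrite -/(Rintegral _ _ _) RintegralB//.
rewrite !RintegralZl//; try exact: integrable_mono_pdf.
rewrite -/(moment _) -/(moment _); ring.
Qed.

(** Stein's identity: multiplying [moment_precision] by row j of Sigma and summing
    over the coordinates leaves a single term, because Sigma A = 1. *)
Lemma moment_incr k j :
  moment (incr k j) =
  mu j 0 * moment k + \sum_i Sigma j i * (k i)%:R * moment (decr k i).
Proof.
under eq_bigr do rewrite -mulrA moment_precision big_distrr/=.
rewrite exchange_big/= (bigD1 j)//= [X in _ + (_ + X)]big1 => [|i ij].
  under eq_bigr do rewrite mulrA.
  rewrite -big_distrl/=.
  have := congr1 (fun M : 'M[R]_n => M j j) (mulmxV (posdefmx_unit pS)).
  by rewrite !mxE eqxx /= => ->; rewrite mul1r addr0 [RHS]addrC subrK.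
under eq_bigr do rewrite mulrA.
rewrite -big_distrl/=.
have := congr1 (fun M : 'M[R]_n => M j i) (mulmxV (posdefmx_unit pS)).
by rewrite !mxE eq_sym (negPf ij) => ->; rewrite mul0r.
Qed.

Lemma incr_decr_comm k i j : i != j -> decr (incr k j) i = incr (decr k i) j.
Proof.
move=> ij; apply/funext => l; rewrite /decr /incr.
have [->|] := eqVneq l i; last by rewrite !subn0.
by rewrite (negPf ij) !addn0.
Qed.

Lemma decr_comm k i j : decr (decr k i) j = decr (decr k j) i.
Proof. by apply/funext => l; rewrite /decr subnAC. Qed.

Lemma decr_incr k j : decr (incr k j) j = k.
Proof. by apply/funext => l; rewrite /decr /incr addnK. Qed.

Lemma incr_decr k j : (0 < k j)%N -> incr (decr k j) j = k.
Proof.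
move=> kj; apply/funext => l; rewrite /decr /incr.
by have [->|_] := eqVneq l j; rewrite ?subnK// subn0 addn0.
Qed.

(** The Leibniz rule: differentiating x_j times a monomial in the direction i
    gives x_j times the derivative of the monomial, plus the monomial itself when
    i = j.  When the exponent k j is 0, incr and decr do not cancel, but the
    coefficient vanishes. *)
Lemma moment_decr_incr k i j :
  (incr k j i)%:R * moment (decr (incr k j) i) =
  (k i)%:R * moment (incr (decr k i) j) + (i == j)%:R * moment k.
Proof.
have [->|ij] := eqVneq i j; last first.
  by rewrite incr_decr_comm// /incr (negPf ij) addn0 mul0r addr0.
rewrite decr_incr {1}/incr eqxx natrD mulrDl; congr (_ + _).
have [->|kj] := posnP (k j); first by rewrite !mul0r.
by rewrite incr_decr.
Qed.

(** Stein's identity applied to both extra factors.  The Leibniz rule makes the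
    first-order sum appear a second time, hence the factor 2. *)
Lemma moment_incr2 k j :
  moment (incr (incr k j) j) =
  mu j 0 ^+ 2 * moment k + Sigma j j * moment k +
  2 * mu j 0 * (\sum_i Sigma j i * (k i)%:R * moment (decr k i)) +
  \sum_i \sum_l Sigma j i * Sigma j l * (k i)%:R * (decr k i l)%:R *
    moment (decr (decr k i) l).
Proof.
rewrite moment_incr moment_incr.
under [X in _ + X = _]eq_bigr do
  rewrite -mulrA moment_decr_incr moment_incr !mulrDr.
rewrite !big_split/=.
rewrite [X in _ + (_ + X)](bigD1 j)//= eqxx mul1r.
rewrite [X in _ + (_ + (_ + X))]big1 => [|i /negPf ->]; last first.
  by rewrite mul0r mulr0.
rewrite [X in _ + (X + _ + _)](_ : _ =
    mu j 0 * \sum_i Sigma j i * (k i)%:R * moment (decr k i)); last first.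
  by rewrite big_distrr/=; apply: eq_bigr => i _; ring.
rewrite [X in _ + (_ + X + _)](_ : _ = \sum_i \sum_l Sigma j i * Sigma j l *
    (k i)%:R * (decr k i l)%:R * moment (decr (decr k i) l)); first by ring.
by apply: eq_bigr => i _; rewrite !big_distrr/=; apply: eq_bigr => l _; ring.
Qed.

End gaussian_density.

(** * Expectations from the density *)

Section density.
Local Open Scope ereal_scope.
Context d (T : measurableType d) (R : realType).
Variables (m : {sigma_finite_measure set T -> \bar R})
  (nu : {finite_measure set T -> \bar R}) (phi : T -> R).
Hypotheses (mphi : measurable_fun setT phi)
  (nuE : forall B, measurable B -> nu B = \int[m]_(x in B) (phi x)%:E).

Let nu_m : nu `<< m.
Proof.
apply/null_content_dominatesP => B mB mB0; rewrite nuE//.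
apply: null_set_integral => //; apply: measurable_funTS.
exact/measurable_EFinP.
Qed.

Let g := Radon_Nikodym_SigmaFinite.f nu m.

Let mg : measurable_fun setT g.
Proof. exact: measurable_int (Radon_Nikodym_SigmaFinite.f_integrable nu_m). Qed.

(* A density is unique up to negligible sets. *)
Let gE : ae_eq m setT g (EFin \o phi).
Proof.
apply: integral_ae_eq => //.
- exact: Radon_Nikodym_SigmaFinite.f_integrable.
- exact/measurable_EFinP.
- move=> B _ mB; rewrite -nuE//.
  by rewrite -(Radon_Nikodym_SigmaFinite.f_integral nu_m).
Qed.

Let ge0_integral_density (f : T -> \bar R) : measurable_fun setT f ->
  (forall x, 0 <= f x) ->
  \int[nu]_x f x = \int[m]_x (f x * (phi x)%:E).
Proof.
move=> mf f0.
rewrite -(Radon_Nikodym_SigmaFinite.change_of_variables nu_m f0 measurableT mf).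
apply: ae_eq_integral => //; last exact: ae_eqe_mul2l gE.
- exact: emeasurable_funM.
- by apply: emeasurable_funM => //; exact/measurable_EFinP.
Qed.

Lemma integrable_density (f : T -> R) : measurable_fun setT f ->
  (forall x, (0 <= phi x)%R) ->
  m.-integrable setT (fun x => (f x * phi x)%:E) ->
  nu.-integrable setT (EFin \o f).
Proof.
move=> mf phi0 /integrableP[_ fphi]; apply/integrableP; split.
  exact/measurable_EFinP.
rewrite ge0_integral_density//; last first.
  by apply: measurableT_comp => //; exact/measurable_EFinP.
apply: le_lt_trans fphi; rewrite le_eqVlt; apply/orP; left; apply/eqP.
by apply: eq_integral => x _; rewrite EFinM abseM [`|(phi x)%:E|]gee0_abs ?lee_fin.
Qed.

Lemma integral_density (f : T -> R) : measurable_fun setT f ->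
  (forall x, (0 <= phi x)%R) ->
  m.-integrable setT (fun x => (f x * phi x)%:E) ->
  \int[nu]_x (f x)%:E = \int[m]_x (f x * phi x)%:E.
Proof.
move=> mf phi0 ifphi.
rewrite -(Radon_Nikodym_change_of_variables nu_m measurableT); last first.
  exact: integrable_density.
apply: ae_eq_integral => //.
- by apply: emeasurable_funM => //; exact/measurable_EFinP.
- exact: measurable_int ifphi.
apply: (@ae_eq_trans _ _ _ m setT _ _ (fun x => (f x)%:E * g x)).
  by apply: ae_eqe_mul2l; apply: ae_eq_sym; exact: ae_eq_Radon_Nikodym_SigmaFinite.
rewrite [X in ae_eq _ _ _ X](_ : _ = (EFin \o f) \* (EFin \o phi))//.
exact: ae_eqe_mul2l gE.
Qed.

End density.

Section mvnormal_moment.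
Context {R : realType} d {T : measurableType d} {P : probability T R} {n : nat}.
Variables (X : 'I_n -> {RV P >-> R}) (mu : 'cV[R]_n) (Sigma : 'M[R]_n).
Hypotheses (pS : posdefmx Sigma) (hX : mvnormal X mu Sigma).
Local Notation RT := (measurableTypeR R).

Lemma expectation_mono (k : 'I_n -> nat) :
  ('E_P[fun w => (\prod_(i < n) X i w ^+ k i)%R] = (moment mu Sigma k)%:E)%E.
Proof.
pose Xv w : n.-tuple RT := [tuple X i w | i < n].
have mXv : measurable_fun setT Xv.
  apply/measurable_fun_tnthP => i.
  rewrite (_ : _ \o _ = X i); first exact: (@measurable_funPT _ _ _ _ (X i)).
  by apply/funext => w /=; rewrite tnth_mktuple.
pose Xf : {mfun T >-> n.-tuple RT} := HB.pack Xv (isMeasurableFun.Build _ _ _ _ _ mXv).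
pose nu := distribution P Xf.
have mf := @measurable_mono R n k.
have ifp := @integrable_mono_pdf R n mu Sigma pS k.
have mp := @measurable_mvnormal_pdf R n mu Sigma.
have p0 := @mvnormal_pdf_ge0 R n mu Sigma.
have [_ inu] := integrableP _ _ _
  (@integrable_density _ _ R (lebesgue_tuple n) nu _ mp hX _ mf p0 ifp).
have mE : measurable_fun setT (EFin \o (mono k : n.-tuple RT -> R)).
  exact/measurable_EFinP.
have iP : P.-integrable setT ((EFin \o mono k) \o Xf).
  apply/integrableP; split; first exact: measurableT_comp.
  rewrite -(@ge0_integral_distribution _ _ _ _ _ P Xf (abse \o (EFin \o mono k)))//.
    exact: measurableT_comp.
  by move=> x; exact: abse_ge0.
have := @integral_density _ _ R (lebesgue_tuple n) nu _ mp hX _ mf p0 ifp.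
rewrite (integral_distribution mE iP) => h; rewrite expectation.unlock.
rewrite /moment /Rintegral fineK; last exact: (integrable_fin_num measurableT ifp).
rewrite -h; apply: eq_integral => w _ /=; congr EFin.
by apply: eq_bigr => i _; rewrite tnth_mktuple.
Qed.

End mvnormal_moment.

(** * Isolating factors and summands *)

Section monomial_factors.
Context {R : comPzRingType} {n : nat} (y : 'I_n -> R) (p q : 'I_n -> nat).

Lemma prod_exprD1 a : (forall i, i != a -> q i = p i) ->
  \prod_i y i ^+ q i = y a ^+ q a * \prod_(i | i != a) y i ^+ p i.
Proof.
move=> qp; rewrite (bigD1 a)//=; congr (_ * _).
by apply: eq_bigr => i ia; rewrite qp.
Qed.

Lemma prod_exprD2 a b : b != a ->
  (forall i, i != a -> i != b -> q i = p i) ->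
  \prod_i y i ^+ q i =
  y a ^+ q a * y b ^+ q b * \prod_(i | (i != a) && (i != b)) y i ^+ p i.
Proof.
move=> ba qp; rewrite (bigD1 a)//= (bigD1 b)//= mulrA; congr (_ * _).
by apply: eq_bigr => i /andP[ia ib]; rewrite qp.
Qed.

Lemma prod_exprD3 a b c : b != a -> c != a -> c != b ->
  (forall i, i != a -> i != b -> i != c -> q i = p i) ->
  \prod_i y i ^+ q i = y a ^+ q a * y b ^+ q b * y c ^+ q c *
    \prod_(i | [&& i != a, i != b & i != c]) y i ^+ p i.
Proof.
move=> ba ca cb qp; rewrite (bigD1 a)//= (bigD1 b)//= (bigD1 c)/= ?ca//.
rewrite !mulrA; congr (_ * _); apply: eq_big => i; first by rewrite andbA.
by move=> /andP[/andP[ia ib] ic]; rewrite qp.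
Qed.

End monomial_factors.

(** By symmetry the row and the column of j0 have the same sum outside the
    diagonal, hence the factor 2. *)
Lemma sum2D1 (R : comPzRingType) (n : nat) (j0 : 'I_n) (F : 'I_n -> 'I_n -> R) :
  (forall i j, i != j -> F i j = F j i) ->
  \sum_i \sum_j F i j = F j0 j0 + 2 * (\sum_(j | j != j0) F j0 j) +
    \sum_(j | j != j0) F j j +
    \sum_(j | j != j0) \sum_(i | (i != j0) && (i != j)) F j i.
Proof.
move=> sF; rewrite (bigD1 j0)//= (bigD1 j0)//=.
have -> : \sum_(i | i != j0) \sum_j F i j =
    \sum_(i | i != j0) (F j0 i + (F i i + \sum_(j | (j != j0) && (j != i)) F i j)).
  apply: eq_bigr => i ij; rewrite (bigD1 j0)//= (bigD1 i)//= sF//.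
by rewrite !big_split/=; ring.
Qed.

Local Open Scope ereal_scope.

(* The dimension is n.+1; the index 1 of the informal statement is ord0. *)
Theorem mainTheorem6 (R : realType) (d : measure_display)
    (T : measurableType d) (P : probability T R) (n : nat)
    (X : 'I_n.+1 -> {RV P >-> R}) (mu : 'cV[R]_n.+1) (Sigma : 'M[R]_n.+1)
    (p : 'I_n.+1 -> nat) :
  posdefmx Sigma ->
  mvnormal X mu Sigma ->
  (2 <= p ord0)%N ->
  'E_P[fun w => (\prod_(i < n.+1) X i w ^+ p i)%R] =
    (Sigma ord0 ord0)%:E *
      'E_P[fun w => (X ord0 w ^+ (p ord0 - 2) *
        \prod_(k < n.+1 | k != ord0) X k w ^+ p k)%R]
  + ((mu ord0 ord0) ^+ 2)%:E *
      'E_P[fun w => (X ord0 w ^+ (p ord0 - 2) *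
        \prod_(k < n.+1 | k != ord0) X k w ^+ p k)%R]
  + (Sigma ord0 ord0 ^+ 2 * (p ord0 - 2)%:R * (p ord0 - 3)%:R)%:E *
      'E_P[fun w => (X ord0 w ^+ (p ord0 - 4) *
        \prod_(k < n.+1 | k != ord0) X k w ^+ p k)%R]
  + 2%:E * \sum_(j < n.+1 | j != ord0)
      (Sigma ord0 ord0 * Sigma j ord0 * (p ord0 - 2)%:R * (p j)%:R)%:E *
      'E_P[fun w => (X ord0 w ^+ (p ord0 - 3) * X j w ^+ (p j - 1) *
        \prod_(k < n.+1 | (k != ord0) && (k != j)) X k w ^+ p k)%R]
  + \sum_(j < n.+1 | j != ord0)
      (Sigma j ord0 ^+ 2 * (p j)%:R * (p j - 1)%:R)%:E *
      'E_P[fun w => (X ord0 w ^+ (p ord0 - 2) * X j w ^+ (p j - 2) *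
        \prod_(k < n.+1 | (k != ord0) && (k != j)) X k w ^+ p k)%R]
  + \sum_(j < n.+1 | j != ord0) \sum_(i < n.+1 | (i != ord0) && (i != j))
      (Sigma j ord0 * Sigma i ord0 * (p j)%:R * (p i)%:R)%:E *
      'E_P[fun w => (X i w ^+ (p i - 1) * X j w ^+ (p j - 1) *
        X ord0 w ^+ (p ord0 - 2) *
        \prod_(k < n.+1 | [&& k != ord0, k != i & k != j]) X k w ^+ p k)%R]
  + (2 * mu ord0 ord0)%:E *
      ((Sigma ord0 ord0 * (p ord0 - 2)%:R)%:E *
        'E_P[fun w => (X ord0 w ^+ (p ord0 - 3) *
          \prod_(k < n.+1 | k != ord0) X k w ^+ p k)%R]
      + \sum_(j < n.+1 | j != ord0)
          (Sigma j ord0 * (p j)%:R)%:E *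
          'E_P[fun w => (X j w ^+ (p j - 1) * X ord0 w ^+ (p ord0 - 2) *
            \prod_(k < n.+1 | (k != ord0) && (k != j)) X k w ^+ p k)%R]).
Proof.
move=> pS hX p2.
(* The exponent at ord0 is lowered twice, then Stein's identity raises it back. *)
pose m := moment mu Sigma; pose r := decr (decr p ord0) ord0.
have r0 : r ord0 = (p ord0 - 2)%N by rewrite /r /decr !eqxx -subnDA.
have rj j : j != ord0 -> r j = p j.
  by move=> /negPf j0; rewrite /r /decr j0 !subn0.
have EE q (f : T -> R) : (forall w, f w = \prod_i X i w ^+ q i)%R ->
    'E_P[f] = (m q)%:E.
  by move=> /funext ->; exact: expectation_mono.
have pE : p = incr (incr r ord0) ord0.
  by rewrite /r !incr_decr ?(ltnW p2)// /decr eqxx subn_gt0.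
rewrite (EE p)//.
have E1 : 'E_P[fun w => (X ord0 w ^+ (p ord0 - 2) *
        \prod_(k < n.+1 | k != ord0) X k w ^+ p k)%R] = (m r)%:E.
  by apply: EE => w; rewrite (prod_exprD1 _ rj) r0.
have E2 : 'E_P[fun w => (X ord0 w ^+ (p ord0 - 3) *
        \prod_(k < n.+1 | k != ord0) X k w ^+ p k)%R] = (m (decr r ord0))%:E.
  apply: EE => w; rewrite (prod_exprD1 (p := p) _ (a := ord0)) => [|i i0].
    by rewrite /decr eqxx r0 -subnDA.
  by rewrite /decr (negPf i0) subn0 rj.
have E3 : 'E_P[fun w => (X ord0 w ^+ (p ord0 - 4) *
        \prod_(k < n.+1 | k != ord0) X k w ^+ p k)%R] =
    (m (decr (decr r ord0) ord0))%:E.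
  apply: EE => w; rewrite (prod_exprD1 (p := p) _ (a := ord0)) => [|i i0].
    by rewrite /decr eqxx r0 -!subnDA.
  by rewrite /decr (negPf i0) !subn0 rj.
have E4 j : j != ord0 -> 'E_P[fun w => (X ord0 w ^+ (p ord0 - 3) * X j w ^+ (p j - 1) *
        \prod_(k < n.+1 | (k != ord0) && (k != j)) X k w ^+ p k)%R] =
    (m (decr (decr r ord0) j))%:E.
  move=> j0; apply: EE => w; rewrite (prod_exprD2 (p := p) _ j0) => [|i i0 ij].
    by rewrite /decr !eqxx (negPf j0) eq_sym (negPf j0) r0 rj// !subn0 -subnDA.
  by rewrite /decr (negPf i0) (negPf ij) !subn0 rj.
have E5 j : j != ord0 -> 'E_P[fun w => (X ord0 w ^+ (p ord0 - 2) * X j w ^+ (p j - 2) *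
        \prod_(k < n.+1 | (k != ord0) && (k != j)) X k w ^+ p k)%R] =
    (m (decr (decr r j) j))%:E.
  move=> j0; apply: EE => w; rewrite (prod_exprD2 (p := p) _ j0) => [|i i0 ij].
    by rewrite /decr !eqxx eq_sym (negPf j0) r0 rj// !subn0 -subnDA.
  by rewrite /decr (negPf ij) !subn0 rj.
have E6 j : j != ord0 -> 'E_P[fun w => (X j w ^+ (p j - 1) * X ord0 w ^+ (p ord0 - 2) *
            \prod_(k < n.+1 | (k != ord0) && (k != j)) X k w ^+ p k)%R] =
    (m (decr r j))%:E.
  move=> j0; apply: EE => w; rewrite (prod_exprD2 (p := p) _ j0) => [|i i0 ij].
    by rewrite /decr !eqxx eq_sym (negPf j0) r0 rj// !subn0 (mulrC (_ ^+ _)%R).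
  by rewrite /decr (negPf ij) !subn0 rj.
have E7 j i : j != ord0 -> i != ord0 -> i != j ->
    'E_P[fun w => (X i w ^+ (p i - 1) * X j w ^+ (p j - 1) *
        X ord0 w ^+ (p ord0 - 2) *
        \prod_(k < n.+1 | [&& k != ord0, k != i & k != j]) X k w ^+ p k)%R] =
    (m (decr (decr r j) i))%:E.
  move=> j0 i0 ij; apply: EE => w.
  rewrite (prod_exprD3 (p := p) _ i0 j0) => [||k k0 ki kj]; last first.
  - by rewrite /decr (negPf kj) (negPf ki) !subn0 rj.
  - by rewrite eq_sym.
  rewrite /decr !eqxx (negPf ij) (eq_sym j) (negPf ij) !(eq_sym ord0).
  rewrite (negPf i0) (negPf j0) r0 !rj// !subn0; congr (_ * _)%R; ring.
rewrite E1 E2 E3.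
under [X in _ + 2%:E * X]eq_bigr => j j0 do rewrite E4// -EFinM.
under [X in _ + X + _ + _]eq_bigr => j j0 do rewrite E5// -EFinM.
under [X in _ + X + _]eq_bigr => j j0.
  under eq_bigr => i /andP[i0 ij] do rewrite E7// -EFinM.
  rewrite sumEFin; over.
under [X in _ * (_ + X)]eq_bigr => j j0 do rewrite E6// -EFinM.
rewrite !sumEFin -!EFinM -!EFinD; congr EFin.
(* Both sides are now real; the second-order identity expands the left one. *)
rewrite [in LHS]pE [LHS]moment_incr2// -/m (sum2D1 ord0) => [|i j ij]; last first.
  by rewrite decr_comm /decr (negPf ij) eq_sym (negPf ij) !subn0; ring.
have sS i j : Sigma i j = Sigma j i by rewrite -[in RHS]pS.1 mxE.
rewrite (bigD1 ord0)//= r0.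
have -> : decr r ord0 ord0 = (p ord0 - 3)%N by rewrite /decr eqxx r0 -subnDA.
rewrite (eq_bigr (fun j => Sigma j ord0 * (p j)%:R * m (decr r j))%R); last first.
  by move=> j j0; rewrite sS rj.
rewrite (eq_bigr (fun j => Sigma ord0 ord0 * Sigma j ord0 * (p ord0 - 2)%:R *
    (p j)%:R * m (decr (decr r ord0) j))%R _ (P := fun j => j != ord0)
    (F1 := fun j => _ * _ * _ * _ * m (decr (decr r ord0) j))%R); last first.
  by move=> j j0; rewrite (sS _ j) {1}/decr (negPf j0) subn0 rj.
rewrite [X in (_ + (_ + X + _) = _)%R](eq_bigr (fun j =>
    Sigma j ord0 ^+ 2 * (p j)%:R * (p j - 1)%:R * m (decr (decr r j) j))%R);
  last first.
  move=> j j0; have -> : decr r j j = (p j - 1)%N by rewrite /decr eqxx rj.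
  by rewrite rj// sS expr2.
rewrite [X in (_ + (_ + X) = _)%R](eq_bigr (fun j =>
    \sum_(i | (i != ord0) && (i != j)) Sigma j ord0 * Sigma i ord0 *
      (p j)%:R * (p i)%:R * m (decr (decr r j) i))%R); last first.
  move=> j j0; apply: eq_bigr => i /andP[i0 ij].
  have -> : decr r j i = p i by rewrite /decr (negPf ij) subn0 rj.
  by rewrite rj// !(sS ord0).
have -> : mu ord0 0%R = mu ord0 ord0 by congr (mu _ _); exact: val_inj.
ring.
Qed.
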